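(* Let $G$ be a simple graph with no isolated vertex such that $\nu(G)\geq 2$, $\Delta(G)\geq 2$ and $$|E(G)|=\Delta(G)\,\nu(G)+\left\lfloor\frac{\nu(G)}{\lceil \Delta(G)/2\rceil}\right\rfloor\left\lfloor\frac{\Delta(G)}{2}\right\rfloor .$$ Then $G$ is unique up to isomorphism (that is, every simple graph $G'$ with no isolated vertex satisfying $\nu(G')=\nu(G)$, $\Delta(G')=\Delta(G)$ and $|E(G')|=|E(G)|$ is isomorphic to $G$) if and only if $\lceil \Delta(G)/2\rceil$ divides $\nu(G)$.
   Context: All graphs are finite. A simple graph has no loops and no multiple edges. $E(G)$ is the edge set of $G$, $\Delta(G)$ is the maximum degree of a vertex of $G$, and $\nu(G)$ is the size (number of edges) of a maximum matching in $G$. *)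

(* Defs.v *)
From mathcomp Require Import all_boot.

Set Implicit Arguments.
Unset Strict Implicit.
Unset Printing Implicit Defensive.

Record sgraph := SGraph {
  vertex :> finType;
  adj : rel vertex;
  adj_sym : symmetric adj;
  adj_irrefl : irreflexive adj
}.

Section Invariants.

Variable G : sgraph.

(* An edge is the unordered pair of its endpoints, so each is counted once. *)
Definition edges : {set {set G}} :=
  [set [set p.1; p.2] | p : G * G & adj p.1 p.2].

Definition degree (x : G) : nat := #|[set y | adj x y]|.

(* The maximum over an empty vertex set is 0. *)
Definition max_degree : nat := \max_(x : G) degree x.

Definition matching (M : {set {set G}}) : bool :=
  (M \subset edges) && trivIset M.

Definition matching_number : nat := \max_(M | matching M) #|M|.

Definition no_isolated_vertex : Prop := forall x : G, exists y : G, adj x y.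

End Invariants.

Definition isomorphic (G H : sgraph) : Prop :=
  exists2 f : G -> H, bijective f & forall x y, adj (f x) (f y) = adj x y.

(* Main.v *)
Require Import Defs.
From mathcomp Require Import all_boot zify.
From mathcomp Require Import ssralg zmodp.

Set Implicit Arguments.
Unset Strict Implicit.
Unset Printing Implicit Defensive.

(** Write [D] for the maximum degree, [b] for [D./2], [c] for [uphalf D] and [n]
    for the matching number.

    The edge bound comes from the Tutte-Berge formula. There are a set [S] of
    vertices and a partition of the vertices into blocks such that every edge
    meets [S] or lies in a block, and [#|S|] plus the sum of the [#|C|./2] is at
    most [n] ([berge_cover]). A vertex of [S] pays for at most [D] edges. A block
    [C] with [s = #|C|./2] spans at most [D * s] edges, except when its size is
    odd and [s >= c], where it spans at most [D * s + b]. In all cases [c] times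
    the number of edges in the block is at most [(D * c + b) * s]
    ([block_weight]), so [c * #|edges G| <= (D * c + b) * n] ([edge_bound]).

    When [c] divides [n], the assumed number of edges means equality in this
    bound. Equality forces [S] to be empty and, as no vertex is isolated, every
    block to have exactly [2 * c + 1] vertices and [D * c + b] edges
    ([extremal_structure]). If [D] is even such a block is complete; if [D] is
    odd every vertex of the block has a non-neighbour in it, and one vertex has two,
    so the complement is a path on three vertices plus disjoint edges. In both
    cases the block is determined ([block_enumeration]), and so is the graph, as it
    consists of [n %/ c] of them ([extremal_encoding]).

    When [c] does not divide [n], let [q] and [r > 0] be quotient and remainder.
    The graph made of [q] extremal blocks and [r] stars with [D] edges is
    extremal. Another one, with a different number of vertices, replaces the
    stars by the complete bipartite graph with sides [r] and [D] if [r > 1], and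
    if [r = 1] it replaces one block and the star by a block on [2 * c + 3]
    vertices ([two_extremal_graphs]). An extremal graph cannot be isomorphic to
    both. In these examples matching numbers need only be bounded from above: the
    number of edges and [edge_bound] give the other inequality
    ([extremal_matching_number]). *)

(** * The Tutte-Berge formula *)

Section Berge.

Variable T : finType.
Implicit Types (E M N : {set {set T}}) (S C : {set T}) (x y : T).

Definition is_matching E M := (M \subset E) && trivIset M.

Definition nu E := \max_(M | is_matching E M) #|M|.

Definition maximum E M := is_matching E M && (#|M| == nu E).

Definition uniform2 E := {in E, forall A : {set T}, #|A| = 2}.

Definition avoiding E S := [set A in E | [disjoint A & S]].

(** The classes of this relation will be the blocks of the cover. It replaces
    connectedness by paths in the usual proof of the formula. *)
Definition twins E : rel T := fun x y =>
  (x == y) || [forall M, maximum E M ==> (x \in cover M) || (y \in cover M)].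

Lemma leq_nu E M : is_matching E M -> #|M| <= nu E.
Proof. exact: leq_bigmax_cond. Qed.

Lemma maximum_exists E : exists M, maximum E M.
Proof.
have [|M mM eM] := @eq_bigmax_cond _ [pred M | is_matching E M] (fun M => #|M|).
  apply/card_gt0P; exists set0; rewrite inE /is_matching sub0set.
  by rewrite /trivIset /cover !big_set0 cards0.
exists M; apply/andP; split; [exact: mM | exact/eqP/esym].
Qed.

Lemma card_cover_matching E M :
  uniform2 E -> is_matching E M -> #|cover M| = 2 * #|M|.
Proof.
move=> E2 /andP[/subsetP sME /eqP <-].
by rewrite (eq_bigr (fun=> 2)) => [|A /sME/E2 //]; rewrite sum_nat_const mulnC.
Qed.

Lemma matching_add E M A : uniform2 E -> is_matching E M -> A \in E ->
  [disjoint A & cover M] -> is_matching E (A |: M) /\ A \notin M.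
Proof.
move=> E2 /andP[sME tM] AE dA.
have [|||tAM AM] := @trivIsetU1 _ A M; last first.
- by split=> //; rewrite /is_matching tAM andbT subUset sub1set AE.
- by apply/negP => /(subsetP sME)/E2; rewrite cards0.
- exact: tM.
- by move=> B BM; apply: disjointWr dA; apply: bigcup_sup.
Qed.

Lemma maximum_meets E M A : uniform2 E -> maximum E M -> A \in E ->
  ~~ [disjoint A & cover M].
Proof.
move=> E2 /andP[mM /eqP eM] AE; apply/negP => dA.
have [mAM AM] := matching_add E2 mM AE dA.
by have := leq_nu mAM; rewrite cardsU1 AM -eM ltnn.
Qed.

Lemma twins_adjacent E x y : uniform2 E -> [set x; y] \in E -> twins E x y.
Proof.
move=> E2 xyE; apply/orP; right; apply/forallP => M; apply/implyP => mM.
have := maximum_meets E2 mM xyE.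
by rewrite disjoints_subset subUset !sub1set !inE; case: (x \in _); case: (y \in _).
Qed.

Lemma twins_sym E : symmetric (twins E).
Proof.
by move=> x y; rewrite /twins eq_sym; under eq_forallb do rewrite orbC.
Qed.

Lemma pair_with (A : {set T}) x : #|A| = 2 -> x \in A ->
  exists2 y, y != x & A = [set x; y].
Proof.
move=> /eqP/cards2P[a [b [nab ->]]]; rewrite !inE => /orP[]/eqP->.
  by exists b; rewrite 1?eq_sym.
by exists a => //; rewrite setUC.
Qed.

(** The exchange step of Gallai's lemma. Among the maximum matchings that miss
    [t], take [N] sharing as many edges as possible with [M0]. By the twin
    hypotheses [N] covers [u] and [v], which [M0] misses; as [M0] and [N] cover
    equally many vertices, [M0] covers some [x] other than [t] that [N] misses.
    Swapping the [M0]-edge at [x] into [N] increases the overlap with [M0]. *)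
Lemma missed_not_twins E u v t M0 N0 : uniform2 E ->
  maximum E N0 -> t \notin cover N0 -> t != u -> t != v -> u != v ->
  maximum E M0 -> u \notin cover M0 -> v \notin cover M0 ->
  twins E u t -> twins E t v -> False.
Proof.
move=> E2 mN0 tN0 tu tv uv mM uM vM tw_ut tw_tv.
have tM : t \in cover M0.
  move: tw_ut; rewrite /twins eq_sym (negPf tu) /= => /forallP/(_ M0).
  by rewrite mM (negPf uM).
have P0 : maximum E N0 && (t \notin cover N0) by rewrite mN0.
case: (@arg_maxnP _ N0 (fun N => maximum E N && (t \notin cover N))
  (fun N => #|M0 :&: N|) P0) => N /andP[mN tN] maxN.
have uN : u \in cover N.
  move: tw_ut; rewrite /twins eq_sym (negPf tu) /= => /forallP/(_ N).
  by rewrite mN (negPf tN) orbF.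
have vN : v \in cover N.
  move: tw_tv; rewrite /twins (negPf tv) /= => /forallP/(_ N).
  by rewrite mN (negPf tN).
case/andP: (mM) => matM /eqP cM; case/andP: (mN) => matN /eqP cN.
have card_cov : #|cover M0| = #|cover N|.
  by rewrite (card_cover_matching E2 matM) (card_cover_matching E2 matN) cM cN.
have card_diff : #|cover M0 :\: cover N| = #|cover N :\: cover M0|.
  by rewrite !cardsD setIC card_cov.
have /card_gt0P[x] : 0 < #|(cover M0 :\: cover N) :\ t|.
  have : 2 <= #|cover M0 :\: cover N|.
    rewrite card_diff.
    suff /subset_leq_card : [set u; v] \subset cover N :\: cover M0.
      by rewrite cards2 uv.
    by rewrite subUset !sub1set !inE uM vM uN vN.
  by rewrite (cardsD1 t (cover M0 :\: cover N)) !inE tM tN add1n.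
rewrite !inE => /and3P[xt xN /bigcupP[A AM xA]].
have AE : A \in E by case/andP: matM => /subsetP sME _; apply: sME.
have [y yx defA] := pair_with (E2 _ AE) xA.
have yN : y \in cover N.
  have := maximum_meets E2 mN AE.
  rewrite defA disjoints_subset subUset !sub1set !inE (negPf xN) /=.
  by rewrite negbK.
case/bigcupP: (yN) => B BN yB.
case/andP: (matN) => sNE tNt.
(* The edge [B] of [N] at the other end [y] of [A] is traded for [A]. *)
have matN' : is_matching E (N :\ B).
  rewrite /is_matching (trivIsetS _ tNt) ?subsetDl // andbT.
  exact: subset_trans (subsetDl _ _) sNE.
have dA : [disjoint A & cover (N :\ B)].
  rewrite defA disjoints_subset subUset !sub1set !inE; apply/andP; split.
    apply: contra xN => /bigcupP[C]; rewrite inE => /andP[_ CN] xC.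
    by apply/bigcupP; exists C.
  apply/negP => /bigcupP[C]; rewrite !inE => /andP[CB CN] yC.
  have := trivIsetP tNt _ _ CN BN CB; rewrite disjoints_subset.
  by move/subsetP/(_ _ yC); rewrite inE yB.
have [matN'' AN'] := matching_add E2 matN' AE dA.
have cN'' : #|A |: (N :\ B)| = #|N| by rewrite cardsU1 AN' (cardsD1 B N) BN.
have AN : A \notin N.
  by apply: contra xN => AN; apply/bigcupP; exists A.
have BM : B \notin M0.
  apply/negP => BM; have [eAB|nAB] := eqVneq A B.
    by rewrite eAB BN in AN.
  case/andP: (matM) => _ /trivIsetP/(_ _ _ AM BM nAB).
  rewrite disjoints_subset => /subsetP/(_ y); rewrite defA !inE eqxx orbT yB.
  by move/(_ isT).
have tN'' : t \notin cover (A |: (N :\ B)).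
  apply/negP => /bigcupP[C]; rewrite !inE => /predU1P[->|/andP[_ CN]] tC.
    move: tC; rewrite defA !inE eq_sym (negPf xt) /= => /eqP tey.
    by rewrite -tey (negPf tN) in yN.
  by case/negP: tN; apply/bigcupP; exists C.
have := maxN (A |: (N :\ B)); rewrite /maximum matN'' tN'' cN'' cN eqxx /=.
move=> /(_ isT); rewrite leqNgt => /negP; apply.
have -> : M0 :&: (A |: N :\ B) = A |: (M0 :&: N).
  apply/setP => C; rewrite !inE; have [->|_] := eqVneq C A; first by rewrite AM.
  have [->|_] := eqVneq C B => //=.
  by rewrite (negPf BM).
by rewrite cardsU1 inE (negPf AN) andbF.
Qed.

(** The hypothesis of Gallai's lemma. *)
Definition every_vertex_missed E :=
  forall x, exists2 M, maximum E M & x \notin cover M.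

Lemma twins_trans E : uniform2 E -> every_vertex_missed E ->
  transitive (twins E).
Proof.
move=> E2 missE t u v tut ttv; rewrite /twins.
have [//|uv] := eqVneq u v; apply/forallP => M; apply/implyP => mM.
have [etu|tu] := eqVneq t u.
  by move: ttv; rewrite etu /twins (negPf uv) => /forallP/(_ M); rewrite mM.
have [etv|tv] := eqVneq t v.
  by move: tut; rewrite etv /twins (negPf uv) => /forallP/(_ M); rewrite mM.
have [N mN tN] := missE t.
apply/negPn/negP; rewrite negb_or => /andP[uM vM].
exact: (missed_not_twins E2 mN tN tu tv uv mM uM vM tut ttv).
Qed.

(** Under Gallai's hypothesis the twin classes are the blocks: an edge joins
    twins since otherwise it could be added to a matching, and a maximum matching
    misses at most one vertex of a class, so it has at least [#|C|./2] edges
    inside the class [C]. *)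
Lemma twin_partition E : uniform2 E -> every_vertex_missed E ->
  exists P : {set {set T}},
    [/\ partition P [set: T],
        {in E, forall A : {set T}, exists2 C, C \in P & A \subset C} &
        \sum_(C in P) #|C|./2 <= nu E].
Proof.
move=> E2 missE; pose P := equivalence_partition (twins E) [set: T].
have eqR : {in [set: T] & &, equivalence_rel (twins E)}.
  move=> x y z _ _ _; split=> [|xy]; first by rewrite /twins eqxx.
  apply/idP/idP; last exact: twins_trans.
  by apply: twins_trans => //; rewrite twins_sym.
have partP : partition P [set: T] := equivalence_partitionP eqR.
have pbE x y : (y \in pblock P x) = twins E x y.
  by rewrite (pblock_equivalence_partition eqR) ?inE.
have covP x : x \in cover P by rewrite (cover_partition partP) inE.
have inP A : A \in E -> exists2 C, C \in P & A \subset C.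
  move=> AE; have /eqP/cards2P[x [y [xy defA]]] := E2 A AE.
  exists (pblock P x); first exact: pblock_mem.
  rewrite defA in AE *; rewrite subUset !sub1set !pbE {1}/twins eqxx.
  exact: twins_adjacent.
exists P; split => //.
have [M mM] := maximum_exists E; case/andP: (mM) => matM /eqP <-.
case/andP: (matM) => sME tM.
have tP := partition_trivIset partP.
have half_le C : C \in P -> #|C|./2 <= \sum_(A in M) (A \subset C).
  move=> CP; pose MC := [set A in M | A \subset C].
  have -> : \sum_(A in M) (A \subset C : nat) = #|MC|.
    rewrite -sum1_card [RHS](eq_bigl (fun A => (A \in M) && (A \subset C))).
      by rewrite big_mkcondr; apply: eq_bigr => A _; case: (A \subset C).
    by move=> A; rewrite inE.
  have sMC : MC \subset M by apply/subsetP => A; rewrite inE => /andP[].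
  have matMC : is_matching E MC.
    by rewrite /is_matching (subset_trans sMC sME) (trivIsetS sMC tM).
  have one : #|C :\: cover MC| <= 1.
    apply/card_le1_eqP => x y; rewrite !inE => /andP[xM xC] /andP[yM yC].
    have out z : z \in C -> z \notin cover MC -> z \notin cover M.
      move=> zC; apply: contra => /bigcupP[A AM zA]; apply/bigcupP; exists A => //.
      rewrite inE AM; have [D DP AD] := inP A (subsetP sME _ AM).
      have zD := subsetP AD _ zA.
      by rewrite -(def_pblock tP CP zC) (def_pblock tP DP zD).
    have : twins E x y by rewrite -pbE (def_pblock tP CP xC).
    case/predU1P => // /forallP/(_ M); rewrite mM /=.
    by rewrite (negPf (out x _ _)) // (negPf (out y _ _)).
  have : #|C| <= 2 * #|MC| + 1.
    rewrite -(card_cover_matching E2 matMC) -(cardsID (cover MC) C).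
    by apply: leq_add => //; apply: subset_leq_card; apply: subsetIr.
  lia.
apply: (@leq_trans (\sum_(C in P) \sum_(A in M) (A \subset C))).
  exact: leq_sum.
rewrite exchange_big /= -sum1_card.
apply: leq_sum => A AM.
have /card_gt0P[x xA] : 0 < #|A| by rewrite (E2 _ (subsetP sME _ AM)).
rewrite (bigD1 (pblock P x)) /= ?pblock_mem // big1 ?addn0; first by case: (_ \subset _).
move=> C /andP[CP nC]; case: (boolP (A \subset C)) => // /subsetP/(_ x xA) xC.
by rewrite (def_pblock tP CP xC) eqxx in nC.
Qed.

(** The min-max cover. With [S] maximal such that deleting [S] lowers the matching
    number by at least [#|S|], what remains satisfies Gallai's hypothesis: a vertex
    lying in every maximum matching could be added to [S]. The vertices of [S]
    are missed by all matchings that avoid [S], so the whole vertex set can be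
    partitioned and no subgraph has to be formed. *)
Theorem berge_cover E : uniform2 E ->
  exists S (P : {set {set T}}),
    [/\ partition P [set: T],
        {in E, forall A : {set T},
          [disjoint A & S] -> exists2 C, C \in P & A \subset C} &
        #|S| + \sum_(C in P) #|C|./2 <= nu E].
Proof.
move=> E2; have P0 : #|@set0 T| + nu (avoiding E set0) <= nu E.
  rewrite cards0 add0n; suff -> : avoiding E set0 = E by [].
  by apply/setP => A; rewrite inE disjoints_subset setC0 subsetT andbT.
case: (@arg_maxnP _ set0 (fun S : {set T} => #|S| + nu (avoiding E S) <= nu E)
  (fun S : {set T} => #|S|) P0) => S leS maxS.
have ES2 : uniform2 (avoiding E S) by move=> A; rewrite inE => /andP[/E2].
have missS : every_vertex_missed (avoiding E S).
  move=> x; case: (boolP (x \in S)) => xS.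
    have [M mM] := maximum_exists (avoiding E S); exists M => //.
    apply/negP => /bigcupP[A AM xA]; case/andP: mM => /andP[/subsetP/(_ A AM)].
    rewrite inE disjoints_subset => /andP[_ /subsetP/(_ x xA)].
    by rewrite inE xS.
  have [M mM] := maximum_exists (avoiding E (x |: S)).
  case/andP: mM => /andP[/subsetP sM tM] /eqP cM.
  have inS A : A \in M -> (A \in avoiding E S) && (x \notin A).
    move/sM; rewrite !inE !disjoints_subset setCU subsetI => /and3P[-> Ax ->] /=.
    by apply: contraL Ax => xA; apply/negP => /subsetP/(_ x xA); rewrite !inE eqxx.
  have matM : is_matching (avoiding E S) M.
    by rewrite /is_matching tM andbT; apply/subsetP => A /inS/andP[].
  exists M; last by apply/negP => /bigcupP[A /inS/andP[_ /negP]].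
  rewrite /maximum matM eqn_leq leq_nu //= cM leqNgt; apply/negP => lt_nu.
  suff /maxS : #|x |: S| + nu (avoiding E (x |: S)) <= nu E.
    by rewrite /= cardsU1 xS; lia.
  by rewrite cardsU1 xS; lia.
have [P [partP inP sumP]] := twin_partition ES2 missS.
exists S, P; split=> //; last by apply: leq_trans leS; rewrite leq_add2l.
by move=> A AE dA; apply: inP; rewrite inE AE.
Qed.

End Berge.

(** * Counting edges through a cover *)

Lemma card_set_sum (T : finType) (C : {set T}) (e : pred T) :
  #|[set y in C | e y]| = \sum_(y in C) e y.
Proof.
rewrite -sum1_card (eq_bigl (fun y => (y \in C) && e y)); last by move=> y; rewrite inE.
by rewrite big_mkcondr; apply: eq_bigr => y _; case: (e y).
Qed.

Lemma handshake (T : finType) (e : rel T) : symmetric e -> irreflexive e ->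
  \sum_x #|[set y | e x y]|
  = 2 * #|[set [set p.1; p.2] | p : T * T & e p.1 p.2]|.
Proof.
move=> e_sym e_irr; pose ends (p : T * T) := [set p.1; p.2].
pose arcs := [pred p : T * T | e p.1 p.2].
transitivity (\sum_(p in arcs) 1).
  rewrite (eq_bigr (fun x => \sum_(y | e x y) 1)) => [|x _]; last by rewrite sum1dep_card.
  by rewrite pair_big_dep.
rewrite (_ : [set _ | p : T * T & _] = ends @: arcs); last first.
  by apply/setP => A; apply/imsetP/imsetP => -[p ep ->]; exists p => //; move: ep; rewrite !inE.
rewrite (partition_big_imset ends) /= mulnC -sum_nat_const.
apply: eq_bigr => A /imsetP[[a b]]; rewrite inE /= => eab ->.
have nab : (a, b) != (b, a).
  by rewrite xpair_eqE; apply/nandP; left; apply/eqP => eq_ab; rewrite eq_ab e_irr in eab.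
rewrite sum1dep_card -[RHS](_ : #|[set (a, b); (b, a)]| = 2); last by rewrite cards2 nab.
congr #|pred_of_set _|; apply/setP => -[x y]; rewrite !inE /ends /=.
apply/andP/orP => [[exy /eqP eq_xy]|[]/eqP[-> ->]]; last 2 first.
- by rewrite eab.
- by rewrite e_sym eab setUC.
have xy : x != y by apply: contraTneq exy => ->; rewrite e_irr.
have: x \in [set a; b] by rewrite -eq_xy set21.
have: y \in [set a; b] by rewrite -eq_xy set22.
by rewrite !inE => /orP[]/eqP ey /orP[]/eqP ex; move: xy; rewrite ex ey ?eqxx; auto.
Qed.

Definition inner_degree (G : sgraph) (C : {set G}) (x : G) :=
  #|[set y in C | adj x y]|.

(** Twice the number of edges inside [C]. *)
Definition inner_sum (G : sgraph) (C : {set G}) :=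
  \sum_(x in C) inner_degree C x.

Section Counting.

Variable G : sgraph.
Implicit Types (S C : {set G}) (P : {set {set G}}).

Lemma sum_degree : \sum_(x : G) degree x = 2 * #|edges G|.
Proof. exact: handshake (@adj_sym G) (@adj_irrefl G). Qed.

Lemma even_inner_sum C : ~~ odd (inner_sum C).
Proof.
pose e x y := [&& x \in C, y \in C & @adj G x y].
have e_sym : symmetric e by move=> x y; rewrite /e adj_sym andbCA.
have e_irr : irreflexive e by move=> x; rewrite /e adj_irrefl !andbF.
suff -> : inner_sum C = \sum_x #|[set y | e x y]|.
  by rewrite handshake // oddM.
rewrite /inner_sum big_mkcond; apply: eq_bigr => x _.
case: ifP => xC; last first.
  by apply/esym/eqP; rewrite cards_eq0; apply/eqP/setP => y; rewrite !inE /e xC.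
by congr #|pred_of_set _|; apply/setP => y; rewrite !inE /e xC.
Qed.

Lemma inner_degree_le C x : inner_degree C x <= degree x.
Proof. by apply: subset_leq_card; apply/subsetP => y; rewrite !inE => /andP[]. Qed.

Lemma inner_degree_lt C x : x \in C -> inner_degree C x <= #|C|.-1.
Proof.
move=> xC; rewrite (cardsD1 x C) xC add1n /=.
apply: subset_leq_card; apply/subsetP => y; rewrite !inE => /andP[-> xy].
by rewrite andbT; apply: contraTneq xy => ->; rewrite adj_irrefl.
Qed.

Lemma inner_sum_le C D : (forall x : G, degree x <= D) -> inner_sum C <= #|C| * D.
Proof.
move=> degD; rewrite -sum_nat_const; apply: leq_sum => x _.
exact: leq_trans (inner_degree_le _ _) (degD x).
Qed.

Lemma inner_sum_le_complete C : inner_sum C <= #|C| * #|C|.-1.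
Proof.
by rewrite -sum_nat_const; apply: leq_sum => x; apply: inner_degree_lt.
Qed.

Lemma edges_uniform2 : uniform2 (edges G).
Proof.
move=> A /imsetP[[x y]]; rewrite inE /= => xy ->; rewrite cards2.
by case: eqVneq xy => // ->; rewrite adj_irrefl.
Qed.

Lemma matching_numberE : matching_number G = nu (edges G).
Proof. by []. Qed.

Lemma leq_max_degree (x : G) : degree x <= max_degree G.
Proof. exact: leq_bigmax. Qed.

Lemma mem_edges (x y : G) : adj x y -> [set x; y] \in edges G.
Proof. by move=> xy; apply/imsetP; exists (x, y); rewrite ?inE. Qed.

(** The degree sum counts twice an edge inside a block. An edge meeting [S] is
    counted once at its end in [S] and once at the other end, which explains the
    factor 2. *)
Lemma sum_degree_cover S P D : (forall x : G, degree x <= D) ->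
  partition P [set: G] ->
  (forall x y : G, adj x y -> x \notin S -> y \notin S -> pblock P x = pblock P y) ->
  \sum_(x : G) degree x <= 2 * D * #|S| + \sum_(C in P) inner_sum C.
Proof.
move=> degD partP sameP.
have tP := partition_trivIset partP.
have covP x : x \in cover P by rewrite (cover_partition partP) inE.
have -> : \sum_(C in P) inner_sum C = \sum_x inner_degree (pblock P x) x.
  transitivity (\sum_(x in [set: G]) inner_degree (pblock P x) x); last first.
    by apply: eq_bigl => x; rewrite inE.
  rewrite (set_partition_big _ partP) /=; apply: eq_bigr => C CP.
  by apply: eq_bigr => x xC; rewrite (def_pblock tP CP xC).
have le_deg x : x \notin S ->
    degree x <= #|[set y in S | adj x y]| + inner_degree (pblock P x) x.
  move=> xS; apply: leq_trans (leq_card_setU _ _); apply: subset_leq_card.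
  apply/subsetP => y; rewrite !inE => xy; rewrite xy !andbT.
  by case: (boolP (y \in S)) => //= yS; rewrite (sameP x y) // mem_pblock.
rewrite (bigID (mem S)) /=.
have leS : \sum_(x in S) degree x <= D * #|S|.
  by rewrite mulnC -sum_nat_const; apply: leq_sum => x _; apply: degD.
have crossS : \sum_(x | x \notin S) #|[set y in S | adj x y]| <= D * #|S|.
  apply: leq_trans leS.
  rewrite (eq_bigr (fun x => \sum_(y in S) adj x y)) => [|x _]; last exact: card_set_sum.
  rewrite exchange_big /=; apply: leq_sum => y yS.
  rewrite /degree -sum1dep_card big_mkcond [leqRHS]big_mkcond /=.
  by apply: leq_sum => x _; rewrite adj_sym; case: (x \notin S); case: (adj y x).
have leP : \sum_(x | x \notin S) inner_degree (pblock P x) x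
    <= \sum_x inner_degree (pblock P x) x.
  by rewrite big_mkcond; apply: leq_sum => x _; case: (x \notin S).
have : \sum_(x | x \notin S) degree x <= D * #|S| + \sum_x inner_degree (pblock P x) x.
  apply: leq_trans (leq_sum (P := fun x => x \notin S) _ (fun x xS => le_deg x xS)) _.
  by rewrite big_split /= leq_add.
rewrite -mulnA mul2n -addnn -addnA; exact: leq_add.
Qed.

End Counting.

(** The next three inequalities compare a block of half-size [s] with its share of
    the bound; [w] is the degree sum inside the block. Here the block is too small
    to have a vertex of degree [D] and is bounded by the complete graph. *)
Lemma odd_block_small D c b s w :
  1 <= b -> 2 * s + 1 <= D -> w <= (2 * s + 1) * (2 * s) ->
  c * w <= 2 * (D * c + b) * s /\ (c * w = 2 * (D * c + b) * s <-> s = 0).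
Proof.
move=> b1 sD ww.
have h1 : w <= 2 * (D * s) by nia.
have h2 : c * w <= 2 * (c * (D * s)) by nia.
have h3 : 2 * (D * c + b) * s = 2 * (c * (D * s)) + 2 * (b * s) by lia.
split; first by lia.
split=> [eq_w|s0]; last by subst s; lia.
have : b * s = 0 by lia.
nia.
Qed.

Lemma even_block D c b s w : 1 <= b -> w <= 2 * s * D ->
  c * w <= 2 * (D * c + b) * s /\ (c * w = 2 * (D * c + b) * s <-> s = 0).
Proof.
move=> b1 h1.
have h2 : c * w <= 2 * (c * (D * s)) by nia.
have h3 : 2 * (D * c + b) * s = 2 * (c * (D * s)) + 2 * (b * s) by lia.
split; first by lia.
split=> [eq_w|s0]; last by subst s; lia.
have : b * s = 0 by lia.
nia.
Qed.

(** The extra [2 * b] is gained once per block, whereas the bound grants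
    [2 * b] for every [c] units of half-size: equality needs [s = c]. *)
Lemma odd_block_big D c b s w :
  1 <= b -> c <= s -> 1 <= c -> w <= 2 * (D * s) + 2 * b ->
  c * w <= 2 * (D * c + b) * s /\
  (c * w = 2 * (D * c + b) * s <-> s = c /\ w = 2 * (D * c + b)).
Proof.
move=> b1 sc c1 ww.
have h2 : c * w <= 2 * (c * (D * s)) + 2 * (b * c) by nia.
have h3 : 2 * (D * c + b) * s = 2 * (c * (D * s)) + 2 * (b * s) by lia.
have h4 : b * c <= b * s by nia.
split; first by lia.
split=> [eq_w|[-> ->]]; last by lia.
have e1 : b * s = b * c by lia.
have es : s = c by nia.
split=> //; subst s; nia.
Qed.

(** The parity of [w] matters when [m] and [D] are odd: then [w <= m * D] improves
    to [w <= 2 * D * m./2 + 2 * D./2]. *)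
Lemma block_weight D m w : 2 <= D -> w <= m * D -> w <= m * m.-1 -> ~~ odd w ->
  uphalf D * w <= 2 * (D * uphalf D + D./2) * m./2
  ?= iff (m <= 1) || ((m == 2 * uphalf D + 1) && (w == 2 * (D * uphalf D + D./2))).
Proof.
move=> D2 wD wm w_even.
have eD := odd_double_half D; have em := odd_double_half m.
have ew := odd_double_half w; rewrite (negPf w_even) add0n in ew.
have ec := uphalf_half D.
set b := D./2 in eD ec *; set s := m./2 in em *; set c := uphalf D in ec *.
have b1 : 1 <= b by move: eD; case: (odd D); lia.
have c1 : 1 <= c by lia.
have split_m : (m <= 1) || ((m == 2 * c + 1) && (w == 2 * (D * c + b)))
  = (s == 0) || [&& odd m, s == c & w == 2 * (D * c + b)].
  by case: (w == _); case: (odd m) em; lia.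
suff [le_w eq_w] : c * w <= 2 * (D * c + b) * s /\
    (c * w = 2 * (D * c + b) * s <->
     s = 0 \/ [/\ odd m, s = c & w = 2 * (D * c + b)]).
  split=> //; rewrite split_m; apply/eqP/orP => [/eq_w|eqs].
    by case=> [->|[-> -> ->]]; [left | right; rewrite !eqxx].
  by apply/eq_w; case: eqs => [/eqP|/and3P[? /eqP ? /eqP ?]]; [left | right].
case: (boolP (odd m)) => m_odd; last first.
  have [le_w eq_w] : c * w <= 2 * (D * c + b) * s /\
      (c * w = 2 * (D * c + b) * s <-> s = 0).
    by apply: even_block => //; move: em wD; rewrite (negPf m_odd) => <-; lia.
  by split=> //; rewrite eq_w; split=> [|[|[]]] //; left.
rewrite m_odd in em; have [sc|cs] := ltnP s c.
  have [|||le_w eq_w] := @odd_block_small D c b s w; try lia.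
  by split=> //; rewrite eq_w; split=> [|[|[_ sc' _]]] //; [left | lia].
have [|le_w eq_w] := @odd_block_big D c b s w b1 cs c1.
  have wD' : w <= 2 * (D * s) + D by move: wD; rewrite -em; lia.
  by case: (odd D) eD; lia.
split=> //; rewrite eq_w; split=> [[-> ->]|[s0|[]//]]; first by right.
by lia.
Qed.

(** Equality in the sum of the bounds for [S] and for the blocks forces [S] to be
    empty, since [S] only gets [D * c] out of [D * c + b] per unit. *)
Lemma cover_arith c b D e k s w n :
  2 * (c * e) <= 2 * (D * c) * k + w -> w <= 2 * (D * c + b) * s -> k + s <= n ->
  c * e <= (D * c + b) * n /\
  (c * e = (D * c + b) * n -> 1 <= b ->
   [/\ k = 0, w = 2 * (D * c + b) * s & w = 2 * (D * c + b) * n]).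
Proof.
move=> le_e le_w le_n; have leW := leq_mul (leqnn (D * c + b)) le_n.
split=> [|eq_e b1]; first by lia.
have bk0 : b * k = 0 by lia.
have k0 : k = 0 by nia.
by split=> //; subst k; lia.
Qed.

Lemma graph_cover (G : sgraph) : exists (S : {set G}) (P : {set {set G}}),
  [/\ partition P [set: G],
      forall x y : G, adj x y -> x \notin S -> y \notin S -> pblock P x = pblock P y &
      #|S| + \sum_(C in P) #|C|./2 <= matching_number G].
Proof.
have [S [P [partP inP leS]]] := berge_cover (@edges_uniform2 G).
exists S, P; split=> // x y xy xS yS; have tP := partition_trivIset partP.
have [|C CP] := inP _ (mem_edges xy).
  by rewrite disjoints_subset subUset !sub1set !inE xS.
rewrite subUset !sub1set => /andP[xC yC].
by rewrite (def_pblock tP CP xC) (def_pblock tP CP yC).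
Qed.

Section Bound.

Variables (G : sgraph) (D : nat).
Hypotheses (D_ge2 : 2 <= D) (degD : forall x : G, degree x <= D).

Let c := uphalf D.
Let b := D./2.

Let block_weightG (C : {set G}) := @block_weight D #|C| (inner_sum C) D_ge2
  (inner_sum_le C degD) (inner_sum_le_complete C) (even_inner_sum C).

Lemma cover_weight (S : {set G}) (P : {set {set G}}) :
  partition P [set: G] ->
  (forall x y : G, adj x y -> x \notin S -> y \notin S -> pblock P x = pblock P y) ->
  2 * (c * #|edges G|) <= 2 * (D * c) * #|S| + \sum_(C in P) c * inner_sum C.
Proof.
move=> partP sameP; rewrite mulnCA -sum_degree -big_distrr /=.
apply: leq_trans (leq_mul (leqnn c) (sum_degree_cover degD partP sameP)) _.
by rewrite mulnDr leq_add2r; lia.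
Qed.

(** The Chvatal-Hanson bound with the floor of [n / c] relaxed to [n / c], where [n]
    is the matching number; nothing is lost when [c] divides [n]. *)
Theorem edge_bound : c * #|edges G| <= (D * c + b) * matching_number G.
Proof.
have [S [P [partP sameP leS]]] := graph_cover G.
have leP : \sum_(C in P) c * inner_sum C
    <= 2 * (D * c + b) * \sum_(C in P) #|C|./2.
  by rewrite big_distrr /=; apply: leq_sum => C _; rewrite block_weightG.
by case: (cover_arith (cover_weight partP sameP) leP leS).
Qed.

(** Equality in [edge_bound] puts equality in [block_weight] for all blocks, so
    each block is a single vertex or extremal. A single vertex would be isolated,
    because [S] is empty. *)
Theorem extremal_structure : no_isolated_vertex G ->
  c * #|edges G| = (D * c + b) * matching_number G ->
  exists P : {set {set G}},
    [/\ partition P [set: G],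
        forall x y : G, adj x y -> pblock P x = pblock P y,
        {in P, forall C : {set G}, #|C| = 2 * c + 1 /\ inner_sum C = 2 * (D * c + b)} &
        c * #|P| = matching_number G].
Proof.
move=> noiso eqE; have [S [P [partP sameP leS]]] := graph_cover G.
have := leqif_sum (fun (C : {set G}) (_ : C \in P) => block_weightG C).
rewrite -[in X in _ <= X ?= iff _]big_distrr -/c -/b /= => -[leP eqW].
have b1 : 1 <= b by rewrite /b; lia.
have [_ /(_ eqE b1)[k0 eq_w eq_n]] := cover_arith (cover_weight partP sameP) leP leS.
have S0 : S = set0 by apply/eqP; rewrite -cards_eq0 k0.
move: eqW; rewrite eq_w eqxx => /esym/forallP full.
have tP := partition_trivIset partP.
have fullP C : C \in P -> #|C| = 2 * c + 1 /\ inner_sum C = 2 * (D * c + b).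
  move=> CP; have := full C; rewrite CP /= => /orP[le1|/andP[/eqP-> /eqP->]//].
  have [x xC] : exists x, x \in C.
    by apply/set0Pn; apply: contraTneq CP => ->; case/and3P: partP.
  have [y xy] := noiso x.
  have yC : y \in C.
    rewrite -(def_pblock tP CP xC) (sameP x y xy) ?S0 ?inE // mem_pblock.
    by rewrite (cover_partition partP) inE.
  by move: xy; rewrite (card_le1_eqP le1 x y xC yC) adj_irrefl.
exists P; split=> //; first by move=> x y xy; apply: sameP; rewrite // S0 inE.
have sumE : \sum_(C in P) c * inner_sum C = #|P| * (c * (2 * (D * c + b))).
  by rewrite -sum_nat_const; apply: eq_bigr => C /fullP[_ ->].
have W0 : 0 < 2 * (D * c + b) by rewrite muln_gt0 addn_gt0 b1 orbT.
by apply/eqP; rewrite -(eqn_pmul2l W0) -eq_n sumE mulnC -mulnA mulnCA.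
Qed.

End Bound.

(** * Extremal blocks are determined *)

(** Partners are listed next to each other, one pair after the other, so that a
    perfect matching becomes the fixed relation [i./2 == j./2] on positions. *)
Lemma pairing_enumeration (T : finType) (e : rel T) (x0 : T) (X : {set T}) :
  symmetric e -> irreflexive e -> {in X, forall x, #|[set y in X | e x y]| = 1} ->
  exists s, [/\ uniq s, s =i X &
    forall i j, i < size s -> j < size s ->
      e (nth x0 s i) (nth x0 s j) = (i != j) && (i./2 == j./2)].
Proof.
move=> e_sym e_irr; have [n] := ubnP #|X|; elim: n X => // n IHn X ltXn oneX.
have [->|/set0Pn[x xX]] := eqVneq X set0.
  by exists [::]; split=> // x; rewrite !inE.
have /eqP/cards1P[y eqy] := oneX x xX.
have : y \in [set z in X | e x z] by rewrite eqy set11.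
rewrite inE => /andP[yX exy].
have yx : y != x by apply: contraTneq exy => ->; rewrite e_irr.
have e_x z : z \in X -> e x z = (z == y).
  by move=> zX; have := in_set1 z y; rewrite -eqy inE zX.
have e_y z : z \in X -> e y z = (z == x).
  have /eqP/cards1P[w eqw] := oneX y yX.
  have : x \in [set w] by rewrite -eqw inE xX e_sym.
  by move/set1P => -> zX; have := in_set1 z w; rewrite -eqw inE zX.
pose X' := X :\ x :\ y.
have sX' : {subset X' <= X} by move=> z; rewrite !inE => /and3P[].
have [||s [s_uniq mem_s s_nth]] := IHn X'.
- by move: ltXn; rewrite (cardsD1 x X) xX (cardsD1 y (X :\ x)) !inE yX yx /X'; lia.
- move=> z zX'; rewrite -(oneX z (sX' z zX')); congr #|pred_of_set _|; apply/setP => w.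
  rewrite !inE; case: (boolP (w \in X)) => wX; rewrite ?andbF // andbT.
  move: zX'; rewrite !inE => /and3P[zy zx zX].
  have [->|_] := eqVneq w y; first by rewrite e_sym e_y // (negPf zx).
  by have [->|//] := eqVneq w x; rewrite e_sym e_x // (negPf zy).
have out z : z \in s -> [/\ z \in X, z != x & z != y].
  by rewrite mem_s !inE => /and3P[].
exists [:: x, y & s]; split.
- rewrite /= s_uniq inE negb_or eq_sym yx /= andbT; apply/andP; split.
    by apply/negP => /out[_ /eqP].
  by apply/negP => /out[_ _ /eqP].
- move=> z; rewrite !inE mem_s !inE.
  have [->|_] := eqVneq z x; first by rewrite xX.
  by have [->|//] := eqVneq z y; first by rewrite yX.
move=> [|[|i]] [|[|j]] //= ltis ltjs; rewrite ?e_irr //.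
- by rewrite e_x; have [zX /negPf zx /negPf zy] := out _ (mem_nth x0 ltjs).
- by rewrite e_sym exy.
- by rewrite e_y; have [zX /negPf zx /negPf zy] := out _ (mem_nth x0 ltjs).
- by rewrite e_sym e_x; have [zX /negPf zx /negPf zy] := out _ (mem_nth x0 ltis).
- by rewrite e_sym e_y; have [zX /negPf zx /negPf zy] := out _ (mem_nth x0 ltis).
by rewrite s_nth // !eqSS.
Qed.

(** The complement of an extremal block for odd degree, on positions 0, 1, 2 and
    so on: the path 1 - 0 - 2 and the edges 3 - 4, 5 - 6 and so on. *)
Definition conflict i j :=
  if (i == 0) || (j == 0) then (i <= 2) && (j <= 2)
  else (2 < i) && (uphalf i == uphalf j).

Definition block_model (o : bool) i j := (i != j) && ~~ (o && conflict i j).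

Section Blocks.

Variables (G : sgraph) (D : nat).
Hypotheses (D_ge2 : 2 <= D) (degD : forall x : G, degree x <= D).

Definition strangers (C : {set G}) x := [set y in C | (x != y) && ~~ adj x y].

Lemma card_strangers (C : {set G}) x : x \in C ->
  inner_degree C x + #|strangers C x| = #|C|.-1.
Proof.
move=> xC; rewrite (cardsD1 x C) xC add1n /= -(cardsID [set y | adj x y] (C :\ x)).
rewrite /inner_degree; congr (_ + _); apply: eq_card => y; rewrite !inE.
  by case: eqVneq => [->|]; rewrite ?adj_irrefl ?andbF.
by rewrite [y == x]eq_sym; case: (x == y); case: (adj x y); case: (y \in C).
Qed.

(** The non-neighbours inside the block add up to [(2 * c + 1) * (2 * c)] minus the
    degree sum, which is 0 if [D] is even and [#|C| + 1] if [D] is odd. In the odd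
    case every vertex has a non-neighbour, because it has [2 * c = D + 1]
    candidates and degree at most [D]; hence a single vertex [a] has two of them,
    [p] and [q], and the remaining vertices are paired off by non-adjacency. *)
Lemma block_enumeration (C : {set G}) x0 :
  #|C| = 2 * uphalf D + 1 -> inner_sum C = 2 * (D * uphalf D + D./2) ->
  exists s, [/\ uniq s, s =i C &
    forall i j, i < size s -> j < size s ->
      adj (nth x0 s i) (nth x0 s j) = block_model (odd D) i j].
Proof.
have eD := odd_double_half D; have := uphalf_half D.
move: (uphalf D) (D./2) eD => c b eD ec cardC sumC.
have sum_str : \sum_(x in C) #|strangers C x| + 2 * (D * c + b) = (2 * c + 1) * (2 * c).
  rewrite -sumC addnC /inner_sum -big_split /= -cardC -sum_nat_const.
  apply: eq_bigr => x xC; rewrite card_strangers // cardC; lia.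
have ge_str x : x \in C -> 2 * c <= D + #|strangers C x|.
  move=> xC; have := card_strangers xC; rewrite cardC.
  have := leq_trans (inner_degree_le C x) (degD x); lia.
case: (boolP (odd D)) => oD; last first.
  rewrite (negPf oD) in eD ec.
  have str0 x : x \in C -> strangers C x = set0.
    move=> xC; apply/eqP; rewrite -cards_eq0; move: sum_str; rewrite (bigD1 x) //=.
    nia.
  exists (enum C); split; [exact: enum_uniq | exact: mem_enum |].
  move=> i j lti ltj; rewrite /block_model andbT.
  have iC : nth x0 (enum C) i \in C by rewrite -mem_enum mem_nth.
  have jC : nth x0 (enum C) j \in C by rewrite -mem_enum mem_nth.
  have [->|nij] := eqVneq i j; first by rewrite adj_irrefl.
  have /setP/(_ (nth x0 (enum C) j)) := str0 _ iC.
  by rewrite !inE jC nth_uniq ?enum_uniq // nij /= => /negbFE.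
rewrite oD in eD ec.
have [eD1 ec1] : D = 2 * b + 1 /\ c = b + 1 by lia.
have str_ge1 x : x \in C -> 1 <= #|strangers C x| by move/ge_str; lia.
have excess : \sum_(x in C) (#|strangers C x| - 1) == 1.
  have : \sum_(x in C) (#|strangers C x| - 1) + #|C| = 2 * b + 4.
    rewrite -sum1_card -big_split /= (eq_bigr (fun x => #|strangers C x|)) => [|x /str_ge1]; last by lia.
    move: (\sum_(x in C) #|strangers C x|) sum_str => t; clear -eD1 ec1; rewrite eD1 ec1; lia.
  by rewrite cardC; lia.
have /sum_nat_eq1[a [aC str_a str_other]] := excess.
have str1 x : x \in C -> x != a -> #|strangers C x| = 1.
  by move=> xC xa; have := str_other x xa xC; have := str_ge1 x xC; lia.
have /eqP/cards2P[p [q [pq eq_pq]]] : #|strangers C a| = 2.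
  by have := str_ge1 a aC; lia.
have str_sym x y : x \in C -> y \in strangers C x -> x \in strangers C y.
  by move=> xC; rewrite !inE xC eq_sym adj_sym => /andP[].
have [pS qS] : p \in strangers C a /\ q \in strangers C a.
  by rewrite eq_pq set21 set22.
have [[pC pa] [qC qa]] : (p \in C /\ p != a) /\ (q \in C /\ q != a).
  by move: pS qS; rewrite !inE ![_ == a]eq_sym => /and3P[-> -> _] /and3P[-> -> _].
have str_pq x : (x == p) || (x == q) -> strangers C x = [set a].
  move=> xpq; have xS : x \in strangers C a by rewrite eq_pq !inE.
  have [xC xa] : x \in C /\ x != a by case/orP: xpq => /eqP->.
  have /eqP/cards1P[y eqy] := str1 x xC xa.
  by have := str_sym _ _ aC xS; rewrite eqy => /set1P->.
have adjE x y : x \in C -> y \in C -> x != y -> adj x y = (y \notin strangers C x).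
  by move=> xC yC xy; rewrite inE yC xy negbK.
pose X := C :\: [set a; p; q].
pose e := fun x y : G => (x != y) && ~~ adj x y.
have e_sym : symmetric e by move=> x y; rewrite /e eq_sym adj_sym.
have e_irr : irreflexive e by move=> x; rewrite /e eqxx.
have inX x : x \in X -> [/\ x \in C, x != a, x != p & x != q].
  by rewrite !inE !negb_or -!andbA => /and4P[].
have strX x y : x \in X -> y \in strangers C x -> y \in X.
  move=> /inX[xC xa xp xq] yS; have yC : y \in C by move: yS; rewrite inE => /andP[].
  have xS := str_sym _ _ xC yS; rewrite !inE yC !negb_or !andbT.
  apply/andP; split; [apply/andP; split|]; apply: contraTneq xS => ->.
  - by rewrite eq_pq !inE negb_or xp.
  - by rewrite str_pq ?eqxx // inE.
  - by rewrite str_pq ?eqxx ?orbT // inE.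
have [|s [s_uniq sX s_nth]] := pairing_enumeration x0 (X := X) e_sym e_irr.
  move=> x xX; have [xC xa _ _] := inX x xX; rewrite -(str1 x xC xa).
  apply: eq_card => y; rewrite inE.
  apply/andP/idP => [[/inX[yC _ _ _] exy]|yS]; first by rewrite inE yC.
  by rewrite (strX x y xX yS); move: yS; rewrite inE => /andP[].
have adj_a y : y \in s -> adj a y.
  by rewrite sX => /inX[yC ya yp yq]; rewrite adjE // 1?eq_sym // eq_pq !inE negb_or yp.
have adj_pq x y : (x == p) || (x == q) -> y \in s -> adj x y.
  move=> xpq; rewrite sX => /inX[yC ya yp yq]; rewrite adjE ?str_pq ?inE //.
    by case/orP: xpq => /eqP->.
  by case/orP: xpq => /eqP->; rewrite eq_sym.
have nadj_a x : x \in strangers C a -> adj a x = false.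
  by rewrite inE => /and3P[_ _ /negPf].
have adjpq : adj p q by rewrite adjE // str_pq ?eqxx // inE.
exists [:: a, p, q & s]; split.
- rewrite /= s_uniq !inE !sX !inE !eqxx !orbT /= !andbT ![a == _]eq_sym.
  by rewrite (negPf pa) (negPf qa) (negPf pq).
- move=> x; rewrite !inE sX !inE.
  have [->|_] := eqVneq x a; first by rewrite aC.
  have [->|_] := eqVneq x p; first by rewrite pC.
  by have [->|_] := eqVneq x q; first by rewrite qC.
have ap := nadj_a p pS; have aq := nadj_a q qS.
move=> [|[|[|i]]] [|[|[|j]]] //= lti ltj; rewrite ?adj_irrefl //.
- by rewrite adj_a ?mem_nth.
- by rewrite adj_sym.
- by rewrite adj_pq ?eqxx ?mem_nth.
- by rewrite adj_sym.
- by rewrite adj_sym.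
- by rewrite adj_pq ?eqxx ?orbT ?mem_nth.
- by rewrite adj_sym adj_a ?mem_nth.
- by rewrite adj_sym adj_pq ?eqxx ?mem_nth.
- by rewrite adj_sym adj_pq ?eqxx ?orbT ?mem_nth.
rewrite /block_model /conflict /= !eqSS.
have [->|nij] := eqVneq i j; first by rewrite adj_irrefl.
have := s_nth i j lti ltj; rewrite /e nij nth_uniq // nij /= => <-.
by rewrite negbK.
Qed.

(** Coordinates of a vertex: its block, and its position in the enumeration of that
    block. The right-hand side depends only on [D] and [q], so two extremal graphs
    with the same parameters are isomorphic. *)
Lemma extremal_encoding q : no_isolated_vertex G -> 0 < q ->
  uphalf D * #|edges G| = (D * uphalf D + D./2) * matching_number G ->
  uphalf D * q = matching_number G ->
  exists2 f : G -> 'I_q * 'I_(2 * uphalf D).+1, bijective f &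
    forall x y, adj x y = ((f x).1 == (f y).1) && block_model (odd D) (f x).2 (f y).2.
Proof.
move=> noiso q_gt0 eqE eq_nu.
have [P [partP sameP fullP card_P]] := extremal_structure D_ge2 degD noiso eqE.
set c := uphalf D; have c_gt0 : 0 < c by rewrite /c; lia.
have eq_q : q = #|P| by apply/eqP; rewrite -(eqn_pmul2l c_gt0) eq_nu card_P.
subst q; have tP := partition_trivIset partP.
have [C0 C0P] : exists C, C \in P by apply/card_gt0P.
have [x0 _] : exists x, x \in C0.
  by apply/card_gt0P; case: (fullP C0 C0P) => ->; rewrite addn1.
have covP x : x \in cover P by rewrite (cover_partition partP) inE.
have pbP x : pblock P x \in P by apply: pblock_mem.
have [s sP] : exists s : {set G} -> seq G, forall C, C \in P -> [/\ uniq (s C), s C =i C &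
    forall i j, i < size (s C) -> j < size (s C) ->
      adj (nth x0 (s C) i) (nth x0 (s C) j) = block_model (odd D) i j].
  apply: (fin_all_exists (P := fun C sC => C \in P -> [/\ uniq sC, sC =i C &
    forall i j, i < size sC -> j < size sC ->
      adj (nth x0 sC i) (nth x0 sC j) = block_model (odd D) i j])) => C.
  case: (boolP (C \in P)) => [CP|_]; last by exists [::].
  by have [cardC sumC] := fullP C CP; have [s] := block_enumeration x0 cardC sumC; exists s.
have size_s C : C \in P -> size (s C) = (2 * c).+1.
  move=> CP; have [s_uniq sC _] := sP C CP.
  by rewrite -(card_uniqP s_uniq) (eq_card sC) (fullP C CP).1 addn1.
have mem_s x : x \in s (pblock P x).
  by have [_ sC _] := sP _ (pbP x); rewrite sC mem_pblock.
pose f x := (enum_rank_in C0P (pblock P x), @inord (2 * c) (index x (s (pblock P x)))).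
have f2 x : (f x).2 = index x (s (pblock P x)) :> nat.
  by rewrite /f inordK // -(size_s _ (pbP x)) index_mem.
have f1 x y : (f x).1 = (f y).1 -> pblock P x = pblock P y.
  by move=> eq1; apply: (enum_rank_in_inj (pbP x) (pbP y) eq1).
exists f.
  apply: inj_card_bij => [x y eq_f|].
    have eq_pb : pblock P x = pblock P y by apply: f1; rewrite eq_f.
    rewrite -(nth_index x0 (mem_s x)) -(nth_index x0 (mem_s y)) -!f2 eq_f.
    by rewrite eq_pb.
  rewrite card_prod !card_ord -cardsT (card_partition partP).
  rewrite (eq_bigr (fun=> (2 * c).+1)) ?sum_nat_const // => C CP.
  by rewrite (fullP C CP).1 addn1.
move=> x y; have [eq1|ne1] /= := eqVneq (f x).1 (f y).1; last first.
  by apply/negP => /sameP eq_pb; rewrite /f /= eq_pb eqxx in ne1.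
have eq_pb := f1 _ _ eq1.
have [_ _ s_nth] := sP _ (pbP x).
rewrite -{1}(nth_index x0 (mem_s x)) -{1}(nth_index x0 (mem_s y)) -eq_pb s_nth.
- by rewrite f2 /= inordK // -(size_s _ (pbP x)) index_mem eq_pb mem_s.
- by rewrite index_mem mem_s.
- by rewrite index_mem eq_pb mem_s.
Qed.

End Blocks.

Lemma encodings_isomorphic (T : finType) (r : rel T) (G H : sgraph) (f : G -> T) (g : H -> T) :
  bijective f -> bijective g -> (forall x y, adj x y = r (f x) (f y)) ->
  (forall x y, adj x y = r (g x) (g y)) -> isomorphic G H.
Proof.
move=> bij_f [h gK hK] adj_f adj_g; exists (h \o f).
  exact: bij_comp (Bijective hK gK) bij_f.
by move=> x y; rewrite adj_g /= !hK adj_f.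
Qed.

(** * Disjoint unions and bipartite graphs *)

(** The matching number is only bounded from above: an upper bound adds up along
    disjoint unions, and for the graphs of interest the number of edges forces
    equality. *)
Record realizes (D n e v : nat) (G : sgraph) : Prop := Realizes {
  realizes_noiso : no_isolated_vertex G;
  realizes_degree : max_degree G = D;
  realizes_matching : matching_number G <= n;
  realizes_edges : #|edges G| = e;
  realizes_card : #|G| = v
}.

Lemma degree_sum (G : sgraph) (x : G) : degree x = \sum_y adj x y.
Proof.
by rewrite /degree -sum1dep_card big_mkcond; apply: eq_bigr => y _; case: (adj x y).
Qed.

Lemma max_degree_eq (G : sgraph) D (x : G) :
  degree x = D -> (forall y : G, degree y <= D) -> max_degree G = D.
Proof.
move=> <- le_deg; apply/eqP; rewrite eqn_leq leq_max_degree andbT.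
by apply/bigmax_leqP => y _; apply: le_deg.
Qed.

Lemma no_isolated_degree (G : sgraph) :
  (forall x : G, 0 < degree x) -> no_isolated_vertex G.
Proof. by move=> deg x; have /card_gt0P[y] := deg x; rewrite inE; exists y. Qed.

Section DisjointUnion.

Variables G H : sgraph.

Definition union_adj (u v : G + H) :=
  match u, v with
  | inl x, inl y => adj x y
  | inr x, inr y => adj x y
  | _, _ => false
  end.

Lemma union_adj_sym : symmetric union_adj.
Proof. by case=> x [] y //=; rewrite adj_sym. Qed.

Lemma union_adj_irrefl : irreflexive union_adj.
Proof. by case=> x /=; rewrite adj_irrefl. Qed.

Definition union := SGraph union_adj_sym union_adj_irrefl.

Lemma degree_inl (x : G) : degree (inl x : union) = degree x.
Proof. by rewrite !degree_sum big_sumType /= big1_eq addn0. Qed.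

Lemma degree_inr (x : H) : degree (inr x : union) = degree x.
Proof. by rewrite !degree_sum big_sumType /= big1_eq add0n. Qed.

Lemma card_edges_union : #|edges union| = #|edges G| + #|edges H|.
Proof.
apply/eqP; rewrite -(@eqn_pmul2l 2) // mulnDr -!sum_degree big_sumType /=.
by under eq_bigr do rewrite degree_inl; under [X in _ + X == _]eq_bigr do rewrite degree_inr.
Qed.

Lemma max_degree_union : max_degree union = maxn (max_degree G) (max_degree H).
Proof.
rewrite /max_degree big_sumType /=.
by congr maxn; apply: eq_bigr => x _; [apply: degree_inl | apply: degree_inr].
Qed.

End DisjointUnion.

(** Applied to both halves of a disjoint union, this makes the matching number
    subadditive. *)
Lemma matching_inside (G H : sgraph) (h : H -> G) (M : {set {set G}}) :
  injective h -> (forall x y, adj (h x) (h y) = adj x y) -> matching M ->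
  #|[set A in M | A \subset codom h]| <= matching_number H.
Proof.
move=> inj_h adj_h /andP[/subsetP sM /trivIsetP tM].
pose M' := [set A in M | A \subset codom h].
have hK A : A \in M' -> h @: (h @^-1: A) = A.
  rewrite inE => /andP[_ /subsetP sA]; apply/setP => x; apply/imsetP/idP.
    by case=> y; rewrite inE => yA ->.
  by move=> xA; have /codomP[y eq_x] := sA x xA; exists y; rewrite ?inE -?eq_x.
have pre_inj : {in M' &, injective (fun A : {set G} => h @^-1: A)}.
  by move=> A B /hK eqA /hK eqB /= eqAB; rewrite -eqA eqAB eqB.
rewrite -/M' -(card_in_imset pre_inj); apply: leq_bigmax_cond.
apply/andP; split.
  apply/subsetP => _ /imsetP[A AM' ->]; have eqA := hK A AM'.
  move: AM'; rewrite inE => /andP[/sM/imsetP[[x y]]]; rewrite inE /= => xy -> /subsetP sxy.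
  have /codomP[x' ex] : x \in codom h by apply: sxy; rewrite set21.
  have /codomP[y' ey] : y \in codom h by apply: sxy; rewrite set22.
  suff -> : h @^-1: [set x; y] = [set x'; y'] by apply: mem_edges; rewrite -adj_h -ex -ey.
  by apply/setP => z; rewrite !inE ex ey !(inj_eq inj_h).
apply/trivIsetP => _ _ /imsetP[A AM' ->] /imsetP[B BM' ->] neAB.
have dAB : [disjoint A & B].
  move: AM' BM'; rewrite !inE => /andP[AM _] /andP[BM _]; apply: tM => //.
  by apply: contraNneq neAB => ->.
rewrite disjoints_subset; apply/subsetP => x; rewrite !inE => xA.
by move: dAB; rewrite disjoints_subset => /subsetP/(_ _ xA); rewrite inE.
Qed.

Lemma matching_number_union (G H : sgraph) :
  matching_number (union G H) <= matching_number G + matching_number H.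
Proof.
apply/bigmax_leqP => M matM.
have leG := @matching_inside (union G H) G inl M inl_inj (fun _ _ => erefl) matM.
have leH := @matching_inside (union G H) H inr M inr_inj (fun _ _ => erefl) matM.
apply: leq_trans (leq_add leG leH); apply: leq_trans (leq_card_setU _ _).
apply: subset_leq_card; apply/subsetP => A AM; rewrite !inE AM /=.
case/andP: matM => /subsetP/(_ A AM)/imsetP[[u v]]; rewrite inE /= => uv -> _.
by case: u v uv => x [] y //= _; apply/orP; [left|right]; apply/subsetP => z;
  rewrite !inE => /orP[]/eqP->; apply: codom_f.
Qed.

Lemma realizes_union D n1 e1 v1 n2 e2 v2 G H :
  realizes D n1 e1 v1 G -> realizes D n2 e2 v2 H ->
  realizes D (n1 + n2) (e1 + e2) (v1 + v2) (union G H).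
Proof.
case=> isoG degG nuG eG vG [isoH degH nuH eH vH]; split.
- case=> x; first by have [y xy] := isoG x; exists (inl y).
  by have [y xy] := isoH x; exists (inr y).
- by rewrite max_degree_union degG degH maxnn.
- exact: leq_trans (matching_number_union _ _) (leq_add nuG nuH).
- by rewrite card_edges_union eG eH.
- by rewrite card_sum vG vH.
Qed.

Lemma realizes_copies D n1 e1 v1 n2 e2 v2 q G H :
  realizes D n1 e1 v1 G -> realizes D n2 e2 v2 H ->
  exists K, realizes D (q * n1 + n2) (q * e1 + e2) (q * v1 + v2) K.
Proof.
move=> rG rH; elim: q => [|q [K rK]]; first by exists H.
by exists (union G K); rewrite !mulSn -!addnA; apply: realizes_union.
Qed.

Lemma matching_vertex_cover (G : sgraph) (S : {set G}) :
  (forall x y : G, adj x y -> (x \in S) || (y \in S)) -> matching_number G <= #|S|.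
Proof.
move=> coverS; apply/bigmax_leqP => M /andP[/subsetP sM tM].
have [f fP] : exists f : {set G} -> option G,
    forall A, A \in M -> exists x, [/\ f A = Some x, x \in A & x \in S].
  exists (fun A => [pick x in A :&: S]) => A /sM/imsetP[[x y]]; rewrite inE /= => xy ->.
  case: pickP => [z|/= none]; first by rewrite inE => /andP[]; exists z.
  have := coverS x y xy; have := none x; have := none y.
  by rewrite !inE !eqxx orbT /= => -> ->.
have inj_f : {in M &, injective f}.
  move=> A B AM BM; have [x [-> xA _]] := fP A AM; have [y [-> yB _]] := fP B BM.
  case=> eq_xy; apply: contraTeq xA => neAB.
  have := trivIsetP tM A B AM BM neAB; rewrite disjoint_sym disjoints_subset.
  by move/subsetP/(_ y yB); rewrite inE eq_xy.
have inj_some : injective (@Some G) by move=> x y [].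
rewrite -(card_in_imset inj_f) -(card_imset S inj_some).
apply: subset_leq_card; apply/subsetP => _ /imsetP[A AM ->].
by have [x [-> _ xS]] := fP A AM; apply: imset_f.
Qed.

Lemma matching_half (G : sgraph) : 2 * matching_number G <= #|G|.
Proof.
have [M /andP[matM /eqP eqM]] := maximum_exists (edges G).
rewrite matching_numberE -eqM -(card_cover_matching (@edges_uniform2 G) matM).
exact: max_card.
Qed.

Section Bipartite.

Variables a D : nat.

Definition bipartite_adj (u v : 'I_a + 'I_D) :=
  match u, v with inl _, inr _ | inr _, inl _ => true | _, _ => false end.

Lemma bipartite_adj_sym : symmetric bipartite_adj.
Proof. by case=> x []. Qed.

Lemma bipartite_adj_irrefl : irreflexive bipartite_adj.
Proof. by case. Qed.

Definition bipartite := SGraph bipartite_adj_sym bipartite_adj_irrefl.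

Lemma realizes_bipartite : 0 < a <= D ->
  realizes D a (a * D) (a + D) bipartite.
Proof.
case/andP=> a_gt0 aD.
have degl (i : 'I_a) : degree (inl i : bipartite) = D.
  by rewrite degree_sum big_sumType /= big1_eq sum_nat_const card_ord muln1.
have degr (j : 'I_D) : degree (inr j : bipartite) = a.
  by rewrite degree_sum big_sumType /= big1_eq sum_nat_const card_ord muln1 addn0.
split.
- by apply: no_isolated_degree => -[i|j]; rewrite ?degl ?degr // (leq_trans a_gt0).
- apply: (@max_degree_eq bipartite D (inl (Ordinal a_gt0)) (degl _)).
  by case=> [i|j]; rewrite ?degl ?degr.
- rewrite -[leqRHS](card_ord a) -(card_imset _ (@inl_inj 'I_a 'I_D)).
  apply: (@matching_vertex_cover bipartite) => -[i|j] [i'|j'] //= _.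
    by rewrite imset_f.
  by rewrite imset_f ?orbT.
- apply/eqP; rewrite -(@eqn_pmul2l 2) // -sum_degree big_sumType /=.
  under eq_bigr do rewrite degl; under [X in _ + X == _]eq_bigr do rewrite degr.
  by rewrite !sum_nat_const !card_ord; lia.
- by rewrite card_sum !card_ord.
Qed.

End Bipartite.

(** * Near-regular graphs of odd order *)

Lemma sum_ord_interval n b : \sum_(i < n) (0 < i <= b) = minn b n.-1.
Proof.
elim: n => [|n IHn]; first by rewrite big_ord0 minn0.
by rewrite big_ord_recr /= IHn; case: (boolP (0 < n <= b)); lia.
Qed.

Lemma sum_ord_eq n k : \sum_(i < n) (k == i :> nat) = (k < n).
Proof.
elim: n => [|n IHn]; first by rewrite big_ord0.
by rewrite big_ord_recr /= IHn; case: (ltngtP k n); lia.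
Qed.

Section Circulant.

Variables s D : nat.

Let b := D./2.

Definition gap (x y : 'I_(2 * s).+1) : nat := (y - x)%R.

Lemma gapE x y : gap x y = if x <= y then y - x else (2 * s).+1 + y - x.
Proof.
rewrite /gap /= modnDmr; have := ltn_ord x; have := ltn_ord y => ltyn ltxn.
case: leqP => xy; last by rewrite modn_small; lia.
by rewrite (_ : y + _ = (y - x) + (2 * s).+1) ?modnDr ?modn_small; lia.
Qed.

(** Translations and reflections permute the cyclic group, so the gaps seen from
    any vertex run through all residues. *)
Lemma sum_gap_from (P : pred nat) x : \sum_y P (gap x y) = \sum_(z < (2 * s).+1) P z.
Proof.
rewrite (reindex_inj (GRing.addIr x)) /=; apply: eq_bigr => z _.
by rewrite /gap GRing.addrK.
Qed.

Lemma sum_gap_to (P : pred nat) x : \sum_y P (gap y x) = \sum_(z < (2 * s).+1) P z.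
Proof.
rewrite (reindex_inj (@GRing.subrI _ x)) /=; apply: eq_bigr => z _.
by rewrite /gap GRing.subKr.
Qed.

Definition short (x y : 'I_(2 * s).+1) := 0 < gap x y <= b.

(** On an odd cycle length [2 * s + 1] the pairs [i], [i + s] with [i < s] match
    all vertices but the last one, at cyclic distance [s]. *)
Definition chord (x y : 'I_(2 * s).+1) := [&& odd D, x < s & x + s == y].

(** Joining vertices at cyclic distance at most [b] gives all degrees [2 * b]. If
    [D] is odd the chords add 1 to all degrees but one; they are new edges since
    then [b < s]. *)
Definition circulant_adj x y := [|| short x y, short y x, chord x y | chord y x].

Hypotheses (D_ge2 : 2 <= D) (cs : uphalf D <= s).

Lemma circulant_adj_sym : symmetric circulant_adj.
Proof.
move=> x y; rewrite /circulant_adj.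
by case: (short x y); case: (short y x); case: (chord x y); case: (chord y x).
Qed.

Lemma circulant_adj_irrefl : irreflexive circulant_adj.
Proof.
move=> x; rewrite /circulant_adj /short /chord !gapE leqnn subnn /=.
by case: (odd D) => //=; lia.
Qed.

Definition circulant := SGraph circulant_adj_sym circulant_adj_irrefl.

Lemma circulant_adjE x y :
  circulant_adj x y = short x y + short y x + chord x y + chord y x :> nat.
Proof.
rewrite /circulant_adj /short /chord !gapE.
have := ltn_ord x; have := ltn_ord y; have := uphalf_half D; rewrite /b.
by case: (odd D) => /=; case: (leqP x y); case: (leqP y x); lia.
Qed.

Lemma degree_circulant (x : circulant) : degree x = 2 * b + (odd D && (x < 2 * s)).
Proof.
rewrite degree_sum (eq_bigr _ (fun y _ => circulant_adjE x y)) !big_split /=.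
have bs : b <= 2 * s by rewrite /b; have := uphalf_half D; lia.
rewrite (sum_gap_from (fun k => 0 < k <= b)) (sum_gap_to (fun k => 0 < k <= b)).
rewrite sum_ord_interval /= (minn_idPl bs) /chord.
have -> : \sum_(y < (2 * s).+1) [&& odd D, x < s & x + s == y] = (odd D && (x < s)).
  case: (odd D) => /=; last by rewrite big1.
  by case: ltnP => xs /=; [rewrite sum_ord_eq; lia | rewrite big1].
have -> : \sum_(y < (2 * s).+1) [&& odd D, y < s & y + s == x] = (odd D && (s <= x < 2 * s)).
  case: (odd D) => /=; last by rewrite big1.
  rewrite (eq_bigr (fun y : 'I_(2 * s).+1 => ((s <= x < 2 * s) && (x - s == y)) : nat)).
    by case: (boolP (s <= x < 2 * s)) => xs /=; [rewrite sum_ord_eq; lia | rewrite big1].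
  by move=> y _; congr nat_of_bool; lia.
by case: (odd D) => /=; lia.
Qed.

Lemma realizes_circulant : realizes D s (D * s + b) (2 * s).+1 circulant.
Proof.
have b_gt0 : 0 < b by rewrite /b; lia.
have s_gt0 : 0 < s by have := uphalf_half D; lia.
have eD : 2 * b + odd D = D by have := odd_double_half D; rewrite /b; lia.
split.
- by apply: no_isolated_degree => x; rewrite degree_circulant; lia.
- apply: (@max_degree_eq circulant D ord0).
    by rewrite degree_circulant [0 < _]muln_gt0 s_gt0 !andbT.
  by move=> x; rewrite degree_circulant -[leqRHS]eD leq_add2l; case: (odd D); case: (_ < _).
- have := matching_half circulant; rewrite card_ord; lia.
- apply/eqP; rewrite -(@eqn_pmul2l 2) // -sum_degree.
  rewrite (eq_bigr _ (fun x _ => degree_circulant x)) big_split /= sum_nat_const card_ord.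
  rewrite big_ord_recr /= ltnn andbF addn0.
  rewrite (eq_bigr (fun=> nat_of_bool (odd D))) => [|x _]; last by rewrite ltn_ord andbT.
  rewrite sum_nat_const card_ord -{2}eD; apply/eqP.
  by move: (b) (nat_of_bool (odd D)) => b' o; lia.
- by rewrite card_ord.
Qed.

End Circulant.

(** * Uniqueness and divisibility *)

Definition extremal_size D n := D * n + (n %/ uphalf D) * D./2.

(** If the matching number were at most [n - 1], the right-hand side of [edge_bound]
    would drop by at least [D * c + b], which exceeds the rounding error
    [b * (n %% c)]. *)
Lemma extremal_matching_number D n v H : 2 <= D ->
  realizes D n (extremal_size D n) v H -> matching_number H = n.
Proof.
move=> D_ge2 [_ degH nuH eH _].
have le_deg (x : H) : degree x <= D by rewrite -degH leq_max_degree.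
have := edge_bound D_ge2 le_deg; rewrite eH /extremal_size => bound.
have c_gt0 : 0 < uphalf D by lia.
have /andP[b_gt0 b_le] : 0 < D./2 <= D by lia.
have r_lt := ltn_pmod n c_gt0; have eq_n := divn_eq n (uphalf D).
apply/eqP; rewrite eqn_leq nuH leqNgt; apply/negP => nu_lt.
move: (uphalf D) (D./2) (n %/ _) (n %% _) c_gt0 b_gt0 b_le bound eq_n r_lt.
move: (matching_number H) nu_lt => k k_lt c b q r c_gt0 b_gt0 b_le bound eq_n r_lt.
have le_k : (D * c + b) * k + (D * c + b) <= (D * c + b) * n.
  by rewrite -mulnSr leq_mul.
have le_r : b * r + b <= b * c by rewrite -mulnSr leq_mul.
have le_b : b * c <= D * c by rewrite leq_mul.
have eq_bn : b * n = b * (q * c) + b * r by rewrite {1}eq_n mulnDr.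
clear -b_gt0 bound le_k le_r le_b eq_bn; lia.
Qed.

(** Let [q] and [r] be quotient and remainder of [n] by [c]. The first graph is
    always [q] blocks with [r] stars. *)
Lemma two_extremal_graphs D n : 2 <= D -> 2 <= n -> ~~ (uphalf D %| n) ->
  exists H1 H2 v1 v2,
    [/\ realizes D n (extremal_size D n) v1 H1,
        realizes D n (extremal_size D n) v2 H2 & v1 <> v2].
Proof.
move=> D_ge2 n_ge2 ndiv; have c_gt0 : 0 < uphalf D by lia.
have cD : uphalf D <= D by lia.
have r_lt := ltn_pmod n c_gt0.
have r_gt0 : 0 < n %% uphalf D by rewrite lt0n.
have eq_n := divn_eq n (uphalf D).
have block := realizes_circulant D_ge2 (leqnn (uphalf D)).
have big_block := realizes_circulant D_ge2 (leqnSn (uphalf D)).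
have star : realizes D 1 D (1 + D) (bipartite 1 D).
  by rewrite -{2}[D]mul1n; apply: realizes_bipartite; lia.
rewrite /extremal_size.
move: (circulant _ _) block => B block; move: (circulant _ _) big_block => B' big_block.
move: (uphalf D) (D./2) (n %/ _) (n %% _) c_gt0 cD r_lt r_gt0 eq_n block big_block.
move=> c b q r c_gt0 cD r_lt r_gt0 eq_n block big_block {ndiv}.
have size_e : D * n + q * b = q * (D * c + b) + r * D by rewrite eq_n; lia.
(* With [r] stars there are [r * (1 + D)] vertices beside the blocks; the complete
   bipartite graph has only [r + D]. *)
have [r_ge2|r_le1] := ltnP 1 r.
  have [stars real_stars] := realizes_copies r.-1 star star.
  have KrD : realizes D r (r * D) (r + D) (bipartite r D).
    by apply: realizes_bipartite; lia.
  have [H1 real1] := realizes_copies q block real_stars.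
  have [H2 real2] := realizes_copies q block KrD.
  have eq_r : r.-1 * 1 + 1 = r by lia.
  have eq_rD : r.-1 * D + D = r * D by rewrite -{2}(prednK r_gt0) mulSn addnC.
  rewrite eq_r eq_rD in real1; rewrite -size_e -eq_n in real1 real2.
  exists H1, H2; do 2!eexists; split; [exact: real1 | exact: real2 |].
  move=> /addnI; rewrite -{2}(prednK r_gt0).
  have : 0 < r.-1 * D by rewrite muln_gt0; lia.
  by rewrite mulnDr; lia.
(* One block and the star have [2 * c + 1] and [D + 1] vertices, the larger block
   only [2 * c + 3]. *)
have r1 : r = 1 by lia.
subst r; have q_gt0 : 0 < q by case: q eq_n size_e => // eq_n; lia.
have [H1 real1] := realizes_copies q block star.
have [H2 real2] := realizes_copies q.-1 block big_block.
exists H1, H2; do 2!eexists; split.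
- by rewrite mul1n in size_e; rewrite -size_e -eq_n in real1; exact: real1.
- have eq_n' : q.-1 * c + c.+1 = n by rewrite eq_n -{2}(prednK q_gt0) mulSn; lia.
  have eq_e' : q.-1 * (D * c + b) + (D * c.+1 + b) = D * n + q * b.
    by rewrite size_e -{2}(prednK q_gt0) mulSn; lia.
  by rewrite eq_n' eq_e' in real2; exact: real2.
- by rewrite -{1}(prednK q_gt0) mulSn; lia.
Qed.

Lemma isomorphic_card (G H : sgraph) : isomorphic G H -> #|G| = #|H|.
Proof. by case=> f bij_f _; apply: bij_eq_card bij_f. Qed.

Theorem theorem1 (G : sgraph)
  (G_noiso : no_isolated_vertex G)
  (nu_ge2 : 2 <= matching_number G)
  (Delta_ge2 : 2 <= max_degree G)
  (card_edges : #|edges G| =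
     max_degree G * matching_number G
     + (matching_number G %/ uphalf (max_degree G)) * (max_degree G)./2) :
  (forall G' : sgraph,
     no_isolated_vertex G' ->
     matching_number G' = matching_number G ->
     max_degree G' = max_degree G ->
     #|edges G'| = #|edges G| ->
     isomorphic G' G)
  <-> uphalf (max_degree G) %| matching_number G.
Proof.
set D := max_degree G in Delta_ge2 card_edges *.
set n := matching_number G in nu_ge2 card_edges *.
split=> [unique | c_dvd_n G' noiso' nu' deg' edges'].
  apply: contraT => ndiv.
  have [H1 [H2 [v1 [v2 [real1 real2 neq_v]]]]] := two_extremal_graphs Delta_ge2 nu_ge2 ndiv.
  have card_G v H : realizes D n (extremal_size D n) v H -> v = #|G|.
    move=> real; have nuH := extremal_matching_number Delta_ge2 real.
    case: real => noisoH degH _ eH <-; apply/isomorphic_card/unique => //.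
    by rewrite eH card_edges.
  by case: neq_v; rewrite (card_G _ _ real1) (card_G _ _ real2).
have c_gt0 : 0 < uphalf D by lia.
have n_eq : uphalf D * (n %/ uphalf D) = n by rewrite mulnC divnK.
have q_gt0 : 0 < n %/ uphalf D.
  by rewrite lt0n; apply: contraTneq nu_ge2 => q0; rewrite -n_eq q0 muln0.
have eq_e : uphalf D * #|edges G| = (D * uphalf D + D./2) * n.
  by rewrite card_edges mulnDr !mulnA n_eq mulnDl (mulnC D) (mulnC D./2).
have degG (x : G) : degree x <= D := leq_max_degree x.
have degG' (x : G') : degree x <= D by rewrite -deg' leq_max_degree.
have eq_e' : uphalf D * #|edges G'| = (D * uphalf D + D./2) * matching_number G'.
  by rewrite edges' nu'.
have n_eq' : uphalf D * (n %/ uphalf D) = matching_number G' by rewrite nu'.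
have [f bij_f adj_f] := extremal_encoding Delta_ge2 degG G_noiso q_gt0 eq_e n_eq.
have [f' bij_f' adj_f'] := extremal_encoding Delta_ge2 degG' noiso' q_gt0 eq_e' n_eq'.
pose r := fun u v : 'I_(n %/ uphalf D) * 'I_(2 * uphalf D).+1 =>
  (u.1 == v.1) && block_model (odd D) u.2 v.2.
exact: (@encodings_isomorphic _ r G' G f' f).
Qed.
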